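(* The class of topological groups with property $(T)$ is closed under arbitrary (possibly infinite) products: if $(\Gamma_i)_{i\in I}$ is any family of topological groups with property $(T)$, then $\prod_{i\in I}\Gamma_i$ with the product topology has property $(T)$.
   Context: All topological groups are Hausdorff; no local compactness is assumed. A strongly continuous unitary representation $\pi$ of a topological group $G$ has almost invariant vectors if for every $\varepsilon>0$ and every compact $K\subseteq G$ there is a unit vector $\xi$ with $\|\xi-\pi_g\xi\|<\varepsilon$ for all $g\in K$. $G$ has property $(T)$ if every strongly continuous unitary representation of $G$ having almost invariant vectors has an invariant unit vector. Equivalently, there are a compact set $Q\subseteq G$ and $\varepsilon>0$ such that every strongly continuous unitary representation of $G$ having a unit vector $\xi$ with $\|\xi-\pi_g\xi\|<\varepsilon$ for all $g\in Q$ has an invariant unit vector. *)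

(* Defs.v *)
From HB Require Import structures.
From mathcomp Require Import all_boot all_order all_algebra.
From mathcomp Require Import sesquilinear complex.
From mathcomp Require Import all_classical all_reals all_analysis.

Set Implicit Arguments.
Unset Strict Implicit.
Unset Printing Implicit Defensive.

Import Order.TTheory GRing.Theory Num.Theory Num.Def.
Import numFieldNormedType.Exports.

Local Open Scope classical_set_scope.
Local Open Scope complex_scope.
Local Open Scope ring_scope.

HB.structure Definition PreTopologicalGroup := {G of Topological G & Group G}.

HB.mixin Record PreTopologicalGroup_isTopologicalGroup G
    & PreTopologicalGroup G := {
  mulg_continuous : continuous (fun x : G * G => (x.1 * x.2)%g) ;
  invg_continuous : continuous (fun x : G => (x^-1)%g) ;
  group_hausdorff : hausdorff_space G ;
}.

#[short(type="topologicalGroupType")]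
HB.structure Definition TopologicalGroup :=
  {G of PreTopologicalGroup G & PreTopologicalGroup_isTopologicalGroup G}.

Section ProductGroup.
Variables (I : Type) (T : I -> topologicalGroupType).
Local Notation P := (prod_topology T).
Local Open Scope group_scope.

Definition prod_one : P := fun i => 1.
Definition prod_inv (f : P) : P := fun i => (f i)^-1.
Definition prod_mul (f g : P) : P := fun i => f i * g i.

Lemma prod_mulA : associative prod_mul.
Proof.
by move=> f g h; apply: functional_extensionality_dep => i; exact: mulgA. Qed.
Lemma prod_mul1g : left_id prod_one prod_mul.
Proof.
by move=> f; apply: functional_extensionality_dep => i; exact: mul1g. Qed.
Lemma prod_mulg1 : right_id prod_one prod_mul.
Proof.
by move=> f; apply: functional_extensionality_dep => i; exact: mulg1. Qed.
Lemma prod_mulVg : left_inverse prod_one prod_inv prod_mul.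
Proof.
by move=> f; apply: functional_extensionality_dep => i; exact: mulVg. Qed.
Lemma prod_mulgV : right_inverse prod_one prod_inv prod_mul.
Proof.
by move=> f; apply: functional_extensionality_dep => i; exact: mulgV. Qed.

HB.instance Definition _ :=
  isGroup.Build P prod_mulA prod_mul1g prod_mulg1 prod_mulVg prod_mulgV.

Lemma prod_proj_continuous i : continuous (fun f : P => f i).
Proof. exact: (@proj_continuous {classic I} (fun j => T j) i). Qed.

Lemma prod_cvg (F : set_system P) {FF : Filter F} (f : P) :
  (forall i, (fun g : P => g i) @ F --> f i) -> F --> f.
Proof.
move=> h; apply/cvg_sup => i.
move=> A [B [[C oC <-] Bf sBA]]; apply: (filterS sBA).
by apply: (h i); apply: open_nbhs_nbhs; split.
Qed.

Lemma prod_mulg_continuous : continuous (fun x : P * P => x.1 * x.2).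
Proof.
move=> x; apply: prod_cvg => i.
apply: (@continuous_comp _ _ _ (fun y : P * P => (y.1 i, y.2 i))
  (fun z : T i * T i => z.1 * z.2) x); last exact: mulg_continuous.
apply: cvg_pair => /=.
  by apply: (@continuous_comp _ _ _ fst (fun f : P => f i));
    [exact: cvg_fst|exact: prod_proj_continuous].
by apply: (@continuous_comp _ _ _ snd (fun f : P => f i));
    [exact: cvg_snd|exact: prod_proj_continuous].
Qed.

Lemma prod_invg_continuous : continuous (fun x : P => x^-1).
Proof.
move=> x; have ? : Filter (nbhs x) by exact: nbhs_filter.
apply: prod_cvg => i.
by apply: (@continuous_comp _ _ _ (fun f : P => f i) (fun z : T i => z^-1));
  [exact: prod_proj_continuous|exact: invg_continuous].
Qed.

Lemma prod_hausdorff : hausdorff_space P.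
Proof.
apply: (@hausdorff_product {classic I} (fun j => T j)) => i.
exact: group_hausdorff.
Qed.

HB.instance Definition _ := PreTopologicalGroup_isTopologicalGroup.Build P
  prod_mulg_continuous prod_invg_continuous prod_hausdorff.

End ProductGroup.

(* [{dot H for conjC}] is a positive definite form, linear in its first argument
   and conjugate-linear in the second; the norm of H takes its values in R[i]. *)
HB.mixin Record CompleteNormedModule_isHilbert (R : realType) H
    & CompleteNormedModule R[i] H := {
  inner : {dot H for conjC} ;
  sqr_normE : forall x : H, `|x| ^+ 2 = inner x x ;
}.

#[short(type="hilbertType")]
HB.structure Definition Hilbert (R : realType) :=
  {H of CompleteNormedModule R[i] H & CompleteNormedModule_isHilbert R H}.

Definition unitary (R : realType) (H : hilbertType R) (U : {linear H -> H}) :=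
  isometry inner inner U /\ bijective U.

Record unitary_rep (R : realType) (G : topologicalGroupType)
    (H : hilbertType R) := UnitaryRep {
  rep_op :> G -> {linear H -> H} ;
  rep_unitary : forall g, unitary (rep_op g) ;
  rep1 : forall x, rep_op 1%g x = x ;
  repM : forall g h x, rep_op (g * h)%g x = rep_op g (rep_op h x) ;
  rep_strongly_continuous : forall x, continuous (fun g => rep_op g x) ;
}.

Definition has_almost_invariant_vectors (R : realType)
    (G : topologicalGroupType) (H : hilbertType R) (pi : unitary_rep G H) :=
  forall (eps : R) (K : set G), 0 < eps -> compact K ->
  exists xi : H, `|xi| = 1 /\ forall g, K g -> `|xi - pi g xi| < eps%:C.

Definition has_invariant_unit_vector (R : realType)
    (G : topologicalGroupType) (H : hilbertType R) (pi : unitary_rep G H) :=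
  exists xi : H, `|xi| = 1 /\ forall g, pi g xi = xi.

Definition property_T (R : realType) (G : topologicalGroupType) : Prop :=
  forall (H : hilbertType R) (pi : unitary_rep G H),
  has_almost_invariant_vectors pi -> has_invariant_unit_vector pi.

(* Main.v *)
(** Suppose the representation pi of the product G has no invariant unit vector.
    For each i, pi restricted to Gamma_i and to the orthogonal complement V_i of
    the Gamma_i-invariant vectors has no invariant unit vector, so property (T)
    gives a compact set and an epsilon_i by which some element of that set must
    move every unit vector of V_i.  Averaging a vector with a translate shrinks
    it, so a power Q_i of that set works with a constant independent of i.  Then
    K = prod_i (Q_i \cup {1}) is compact, and there is a constant c > 0 such that
    every x fixed by all but finitely many factors is moved by at least c |x| by
    some element of K: split x into its Gamma_i-invariant part and its part in
    V_i for one factor at a time, choosing the i-th coordinate in {1, h}.  Finally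
    a (K, epsilon)-invariant unit vector is, by strong continuity, hardly moved by
    the subgroup of elements trivial on a finite set of coordinates, so the vector
    of least norm in the closed convex hull of its orbit under that subgroup is
    close to it and fixed by the subgroup, a contradiction. *)

Require Import Defs.
From HB Require Import structures.
From mathcomp Require Import all_boot all_order all_algebra.
From mathcomp Require Import sesquilinear complex ring lra.
From mathcomp Require Import all_classical all_reals all_analysis.

Set Implicit Arguments.
Unset Strict Implicit.
Unset Printing Implicit Defensive.

Import Order.TTheory GRing.Theory Num.Theory Num.Def.
Import numFieldNormedType.Exports.

Local Open Scope classical_set_scope.
Local Open Scope complex_scope.
Local Open Scope ring_scope.

Lemma Re_realM (R : realType) (a : R) (z : R[i]) :
  complex.Re (a%:C * z) = a * complex.Re z.
Proof. by case: z => u v; rewrite /= mul0r subr0. Qed.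

(** * Real geometry of a Hilbert space and least-norm vectors of closed convex sets *)

Section HilbertGeometry.
Variables (R : realType) (H : hilbertType R).
Implicit Types (x y z : H) (D : set H) (e : R).

(** The inner product and the norm take values in [R[i]]. The real part gives a Euclidean structure
    with the same norm, on which order arguments and [lra] work; pairing with ['i%C *: y] recovers
    the imaginary part. *)
Definition rdot x y : R := complex.Re (inner x y).
Definition sqnrm x : R := rdot x x.
Definition nrm x : R := complex.Re `|x|.

Lemma innerC x y : inner x y = (inner y x)^*%R.
Proof. by rewrite hermC expr0 mul1r. Qed.

Lemma rdotC x y : rdot x y = rdot y x.
Proof. by rewrite /rdot innerC; case: (inner y x). Qed.

Lemma rdotDl x y z : rdot (x + y) z = rdot x z + rdot y z.
Proof. by rewrite /rdot linearDl raddfD. Qed.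

Lemma rdotNl x y : rdot (- x) y = - rdot x y.
Proof. by rewrite /rdot linearNl raddfN. Qed.

Lemma rdotZl (a : R) x y : rdot (a%:C *: x) y = a * rdot x y.
Proof.
by rewrite /rdot linearZl_LR Re_realM.
Qed.

Lemma rdotDr x y z : rdot x (y + z) = rdot x y + rdot x z.
Proof. by rewrite rdotC rdotDl !(rdotC x). Qed.

Lemma rdotNr x y : rdot x (- y) = - rdot x y.
Proof. by rewrite rdotC rdotNl rdotC. Qed.

Lemma rdotZr (a : R) x y : rdot x (a%:C *: y) = a * rdot x y.
Proof. by rewrite rdotC rdotZl rdotC. Qed.

Lemma normE x : `|x| = (nrm x)%:C.
Proof. by rewrite /nrm RRe_real // ger0_real. Qed.

Lemma nrm_ge0 x : 0 <= nrm x.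
Proof. by rewrite -ler0c -normE. Qed.

Lemma nrmD x y : nrm (x + y) <= nrm x + nrm y.
Proof. by rewrite -lecR rmorphD /= -!normE ler_normD. Qed.

Lemma nrmN x : nrm (- x) = nrm x.
Proof. by rewrite /nrm normrN. Qed.

Lemma nrmBC x y : nrm (x - y) = nrm (y - x).
Proof. by rewrite -nrmN opprB. Qed.

Lemma sqnrmE x : sqnrm x = nrm x ^+ 2.
Proof.
by apply: complexI; rewrite rmorphXn /= -normE sqr_normE /sqnrm /rdot
  RRe_real // -sqr_normE ger0_real ?exprn_ge0.
Qed.

Lemma sqnrm_ge0 x : 0 <= sqnrm x.
Proof. by rewrite sqnrmE exprn_ge0 ?nrm_ge0. Qed.

Lemma sqnrm_eq0 x : sqnrm x = 0 -> x = 0.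
Proof.
by move/eqP; rewrite sqnrmE sqrf_eq0 => /eqP n0; apply/normr0_eq0; rewrite normE n0.
Qed.

Lemma sqnrmN x : sqnrm (- x) = sqnrm x.
Proof. by rewrite !sqnrmE nrmN. Qed.

Lemma sqnrm0 : sqnrm 0 = 0.
Proof. by rewrite sqnrmE /nrm normr0 expr0n. Qed.

Lemma sqnrmZ (a : R) x : sqnrm (a%:C *: x) = a ^+ 2 * sqnrm x.
Proof. by rewrite /sqnrm rdotZl rdotZr mulrA expr2. Qed.

Lemma sqnrmD x y : sqnrm (x + y) = sqnrm x + 2 * rdot x y + sqnrm y.
Proof. by rewrite /sqnrm !(rdotDl, rdotDr) (rdotC y x); ring. Qed.

Lemma sqnrmB x y : sqnrm (x - y) = sqnrm x - 2 * rdot x y + sqnrm y.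
Proof. by rewrite sqnrmD rdotNr sqnrmN; ring. Qed.

Lemma sqnrm_lt x e : 0 < e -> (sqnrm x < e ^+ 2) = (nrm x < e).
Proof. by move=> e0; rewrite sqnrmE ltr_pXn2r ?nnegrE ?nrm_ge0// ltW. Qed.

(** Cauchy-Schwarz: the square norm of [(sqnrm y)%:C *: x - (rdot x y)%:C *: y] expands to [sqnrm y]
    times the difference of the two squared sides. *)
Lemma rdot_le_nrm x y : `|rdot x y| <= nrm x * nrm y.
Proof.
have := sqnrm_ge0 ((sqnrm y)%:C *: x - (rdot x y)%:C *: y).
rewrite sqnrmB !sqnrmZ rdotZl rdotZr => h.
have [y0|y0] := eqVneq (sqnrm y) 0.
  by rewrite (sqnrm_eq0 y0) /rdot linear0r raddf0 normr0 mulr_ge0 ?nrm_ge0.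
rewrite -(@ler_pXn2r _ 2) ?nnegrE ?mulr_ge0 ?nrm_ge0 //.
rewrite exprMn -!sqnrmE real_normK ?num_real //.
have yp : 0 < sqnrm y by rewrite lt0r y0 sqnrm_ge0.
rewrite -subr_ge0 -(pmulr_rge0 _ yp); apply: le_trans h _.
by rewrite le_eqVlt; apply/orP; left; apply/eqP; ring.
Qed.

Definition adherent D x := forall e, 0 < e -> exists2 y, D y & nrm (x - y) < e.

Lemma hilbert_complete (u : nat -> H) :
    (forall e, 0 < e -> exists N, forall m n, (N <= m)%N -> (N <= n)%N ->
      nrm (u m - u n) < e) ->
  exists l, forall e, 0 < e -> exists N, forall n, (N <= n)%N -> nrm (l - u n) < e.
Proof.
move=> cu; have cuF : cauchy (u @ \oo).
  apply/cauchy_ballP => -[e ei] e0.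
  (* A positive element of [R[i]] has zero imaginary part, so the radius is real. *)
  move: e0; rewrite ltcE /= => /andP[/eqP ei0 e0]; rewrite {}ei0.
  have [N hN] := cu e e0.
  exists ([set u n | n in [set n | (N <= n)%N]],
          [set u n | n in [set n | (N <= n)%N]]).
    by split; exists N => // n /= Nn; exists n.
  move=> [_ _] [/= [m Nm <-] [n Nn <-]].
  by rewrite -ball_normE /= normE ltcR hN.
have /cvgrPdist_lt ul : u @ \oo --> lim (u @ \oo) by exact: cauchy_cvg.
move: (lim _) ul => l ul.
exists l => e e0; have e0' : 0 < e%:C by rewrite ltcR.
have [N _ hN] := ul _ e0'.
by exists N => n Nn; rewrite -ltcR -normE; exact: hN.
Qed.

(* For a closed set, stability under midpoints is equivalent to convexity. *)
Definition closed_convex D :=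
  (forall x y, D x -> D y -> D (2^-1%:C *: (x + y))) /\
  (forall x, adherent D x -> D x).

Lemma parallelogram x y :
  sqnrm (x - y) = 2 * sqnrm x + 2 * sqnrm y - 4 * sqnrm (2^-1%:C *: (x + y)).
Proof. by rewrite sqnrmZ sqnrmB sqnrmD; field. Qed.

(** A minimizing sequence is Cauchy by the parallelogram identity, since midpoints stay in [D]; its
    limit is the minimizer. *)
Lemma closed_convex_min D : closed_convex D -> D !=set0 ->
  exists2 x, D x & forall y, D y -> sqnrm x <= sqnrm y.
Proof.
move=> [Dmid Dcl] [x0 Dx0].
have [d [d0 hd d_inf]] : exists d, [/\ 0 <= d, forall y, D y -> d <= sqnrm y &
    forall e, 0 < e -> exists2 y, D y & sqnrm y < d + e].
  have hi : has_inf [set sqnrm y | y in D].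
    by split; [exists (sqnrm x0), x0|exists 0 => _ [y _ <-]; exact: sqnrm_ge0].
  exists (inf [set sqnrm y | y in D]); split=> [|y Dy|e e0].
  - by apply: lb_le_inf => [|_ [y _ <-]]; [exact: hi.1|exact: sqnrm_ge0].
  - by apply: ge_inf; [exact: hi.2|exists y].
  - by have [_ [y Dy <-] h] := inf_adherent e0 hi; exists y.
have /choice[u hu] n : exists y, D y /\ sqnrm y < d + n.+1%:R^-1.
  by have [|y] := d_inf n.+1%:R^-1; [rewrite invr_gt0|exists y].
(* The midpoint has square norm at least [d], so the terms in [d] cancel in the parallelogram
   identity. *)
have u_cauchy m n : sqnrm (u m - u n) < 2 * (m.+1%:R^-1 + n.+1%:R^-1).
  have [Dm um] := hu m; have [Dn un] := hu n.
  have := hd _ (Dmid _ _ Dm Dn); rewrite parallelogram.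
  by move: (sqnrm (_ *: _)) (m.+1%:R^-1) (n.+1%:R^-1) um un => c a b um un h; lra.
have inv_small e : 0 < e -> exists N, forall n, (N <= n)%N -> n.+1%:R^-1 < e.
  move=> e0; have [N _ hN] := near_infty_natSinv_lt (PosNum e0).
  by exists N => n Nn; exact: hN.
have [|l hl] := @hilbert_complete u.
  move=> e e0; have e4 : 0 < e ^+ 2 / 4 by rewrite divr_gt0 ?exprn_gt0.
  have [N hN] := inv_small _ e4; exists N => m n Nm Nn.
  rewrite -sqnrm_lt //; apply: lt_trans (u_cauchy m n) _.
  by move: (m.+1%:R^-1) (n.+1%:R^-1) (hN _ Nm) (hN _ Nn) => a b ha hb; lra.
have Dl : D l.
  apply: Dcl => e /hl[N hN]; exists (u N); [exact: (hu N).1|exact: hN].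
exists l => // y Dy; apply: le_trans (hd _ Dy).
(* It suffices that [nrm l <= Num.sqrt d + e]. Half of [e] pays for the distance from [l] to [u n];
   the other half bounds [nrm (u n)] once the excess of its square over [d] is below
   [(e / 2) ^+ 2]. *)
rewrite sqnrmE -(sqr_sqrtr d0) ler_pXn2r ?nnegrE ?nrm_ge0 ?sqrtr_ge0 //.
apply/ler_addgt0Pr => e e0; have e2 : 0 < e / 2 by rewrite divr_gt0.
have [N hN] := hl _ e2.
have [M hM] := inv_small _ (exprn_gt0 2 e2).
pose n := maxn N M.
have h1 : nrm (l - u n) < e / 2 by apply: hN; rewrite leq_maxl.
have h2 : nrm (u n) <= Num.sqrt d + e / 2.
  rewrite -(@ler_pXn2r _ 2) ?nnegrE ?nrm_ge0 ?addr_ge0 ?sqrtr_ge0 ?(ltW e2) //.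
  rewrite -sqnrmE sqrrD sqr_sqrtr //.
  have p0 : 0 <= Num.sqrt d * (e / 2) *+ 2.
    by apply/mulrn_wge0/mulr_ge0; [exact: sqrtr_ge0|exact: ltW].
  by move: (_ *+ 2) (n.+1%:R^-1) p0 (hu n).2 (hM n (leq_maxr _ _)) => q a q0 h3 h4; lra.
have := nrmD (l - u n) (u n); rewrite subrK; lra.
Qed.

Lemma closed_convex_min_unique D x y : closed_convex D ->
  D x -> D y -> (forall z, D z -> sqnrm x <= sqnrm z) -> sqnrm y = sqnrm x -> y = x.
Proof.
move=> [Dmid _] Dx Dy xmin exy.
apply/eqP; rewrite -subr_eq0; apply/eqP/sqnrm_eq0/eqP.
rewrite eq_le sqnrm_ge0 andbT parallelogram exy.
by have := xmin _ (Dmid _ _ Dy Dx); lra.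
Qed.

Lemma closed_convex_ball x r : closed_convex [set y | nrm (y - x) <= r].
Proof.
split=> [y z /= hy hz|y hy /=].
  have -> : 2^-1%:C *: (y + z) - x = 2^-1%:C *: ((y - x) + (z - x)).
    rewrite addrACA -opprD scalerBr; congr (_ - _).
    have -> : x + x = 2%:C *: x by rewrite (natrD _ 1 1) rmorphD scalerDl scale1r.
    by rewrite scalerA -rmorphM mulVf ?pnatr_eq0 // scale1r.
  have := nrmD (y - x) (z - x).
  have -> : nrm (2^-1%:C *: (y - x + (z - x))) = 2^-1 * nrm (y - x + (z - x)).
    apply: complexI; rewrite rmorphM /= -!normE normrZ; congr (_ * _).
    by rewrite ger0_norm // ler0c invr_ge0.
  lra.
apply/ler_addgt0Pr => e /hy[z /= hz hyz].
by have := nrmD (y - z) (z - x); rewrite addrA subrK; lra.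
Qed.

(** Carries linear information from an orbit to its closed convex hull. Closedness comes from
    Cauchy-Schwarz; dividing by [nrm w + 1] covers [w = 0]. *)
Lemma closed_convex_hyperplane w (c : R) : closed_convex [set y | rdot y w = c].
Proof.
split=> [y z /= hy hz|y hy /=].
  by rewrite rdotZl rdotDl hy hz; field.
apply/eqP; rewrite -subr_eq0 -normr_eq0 eq_le normr_ge0 andbT.
apply/ler_addgt0Pl => e e0; rewrite addr0.
have w1 : 0 < nrm w + 1 by rewrite ltr_wpDl ?nrm_ge0.
have [z /= <- hz] := hy (e / (nrm w + 1)) (divr_gt0 e0 w1).
rewrite -rdotNl -rdotDl; apply: le_trans (rdot_le_nrm _ _) _.
rewrite ltr_pdivlMr // in hz; apply: le_trans (ltW hz).
by rewrite ler_wpM2l ?nrm_ge0 // lerDl.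
Qed.

End HilbertGeometry.

(** * The orthogonal complement of a set as a Hilbert space *)

Section OrthogonalComplement.
Variables (R : realType) (H : hilbertType R) (W : set H).

(** Boolean-valued, so that the complement is a subtype inheriting the module structure of [H]. *)
Definition orthogonal_pred : pred H :=
  fun x => `[< forall w, W w -> inner x w = 0 >].

Lemma orthogonal_closed : subsemimod_closed orthogonal_pred.
Proof.
apply: GRing.submod_closed_semi; split=> [|a x y /asboolP hx /asboolP hy].
  by apply/asboolP => w _; rewrite linear0l.
by apply/asboolP => w Ww; rewrite linearDl linearZl_LR /= hx // hy // mulr0 addr0.
Qed.

Record orth := Orth { orth_val :> H ; orth_valP : orthogonal_pred orth_val }.

HB.instance Definition _ := [isSub for orth_val].
HB.instance Definition _ := [Choice of orth by <:].
HB.instance Definition _ :=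
  GRing.SubChoice_isSubLmodule.Build R[i] H orthogonal_pred orth orthogonal_closed.

Definition orth_norm (x : orth) : R[i] := `|val x|.

Lemma orth_normD x y : orth_norm (x + y) <= orth_norm x + orth_norm y.
Proof. by rewrite /orth_norm raddfD ler_normD. Qed.

Lemma orth_normZ (l : R[i]) x : orth_norm (l *: x) = `|l| * orth_norm x.
Proof. by rewrite /orth_norm linearZ normrZ. Qed.

Lemma orth_norm_eq0 x : orth_norm x = 0 -> x = 0.
Proof. by move/normr0_eq0 => x0; apply: val_inj; rewrite x0 raddf0. Qed.

HB.instance Definition _ :=
  Lmodule_isNormed.Build R[i] orth orth_normD orth_normZ orth_norm_eq0.

Lemma orth_normE (x : orth) : `|x| = `|val x|.
Proof. by []. Qed.

Lemma orthogonal_adherent (x : H) :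
  adherent [set y | orthogonal_pred y] x -> orthogonal_pred x.
Proof.
move=> adx.
have rdot0 w : (forall y, orthogonal_pred y -> inner y w = 0) -> rdot x w = 0.
  move=> hw; have [_ cl] := closed_convex_hyperplane w 0.
  apply: cl => e /adx[y hy xy]; exists y => //=.
  by rewrite /rdot hw.
apply/asboolP => w Ww.
have hw y : orthogonal_pred y -> inner y w = 0 by move/asboolP; apply.
have re0 := rdot0 _ hw.
(* Pairing with ['i%C *: w] turns the imaginary part of [inner x w] into a real part. *)
have /rdot0 : forall y, orthogonal_pred y -> inner y ('i%C *: w) = 0.
  by move=> y /hw yw; rewrite linearZr_LR /= yw mulr0.
rewrite /rdot linearZr_LR /=; move: re0; rewrite /rdot.
case: (inner x w) => a b /= ->; rewrite /conjC /= => h.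
by move: h; rewrite mul0r sub0r mulN1r opprK => ->.
Qed.

(** The image filter converges in [H], and its limit stays in the complement because the complement
    is closed. *)
Lemma orth_complete (F : set_system orth) :
  ProperFilter F -> cauchy F -> cvg F.
Proof.
move=> FF /cauchy_ballP cF.
pose G : set_system H := val @ F.
have /cvgrPdist_lt Gl : G --> lim G.
  apply: cauchy_cvg; apply/cauchy_ballP => e /cF[[A B] /= [FA FB] AB].
  exists (val @` A, val @` B).
    by split; [apply: filterS FA|apply: filterS FB] => x; exists x.
  move=> [_ _] [/= [x Ax <-] [y By <-]].
  by have := AB (x, y) (conj Ax By); rewrite -!ball_normE /= orth_normE raddfB.
move: (lim G) Gl => l Gl.
have ol : orthogonal_pred l.
  apply: orthogonal_adherent => e; rewrite -ltcR => /Gl Fe.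
  have [x /= lx] := filter_ex Fe.
  by exists (val x); [exact: orth_valP|rewrite -ltcR -normE].
apply/cvg_ex; exists (Orth ol); apply/cvgrPdist_lt => e /Gl.
by apply: filterS => x /=; rewrite orth_normE raddfB.
Qed.

HB.instance Definition _ := Uniform_isComplete.Build orth orth_complete.

Definition orth_inner (x y : orth) : R[i] := inner (val x) (val y).

Lemma orth_inner_bilinear :
  bilinear_for *%R (conjC \; *%R) orth_inner.
Proof.
have val_lin (a : R[i]) (x y : orth) : val (a *: x + y) = a *: val x + val y.
  by rewrite linearP.
split=> u a x y; rewrite /orth_inner val_lin.
  by rewrite linearDl linearZl_LR.
by rewrite linearDr linearZr_LR.
Qed.

HB.instance Definition _ := bilinear_isBilinear.Build R[i] orth orth R[i]
  *%R (conjC \; *%R) orth_inner orth_inner_bilinear.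

Lemma orth_inner_herm (x y : orth) :
  orth_inner x y = (-1) ^+ false * conjC (orth_inner y x).
Proof. exact: hermC. Qed.

HB.instance Definition _ := isHermitianSesquilinear.Build R[i] orth false conjC
  orth_inner orth_inner_herm.

Lemma orth_inner_gt0 (x : orth) : x != 0 -> 0 < orth_inner x x.
Proof. by move=> x0; apply: neq0_dnorm_gt0; rewrite -(inj_eq val_inj) raddf0 in x0 *. Qed.

HB.instance Definition _ := isDotProduct.Build R[i] orth orth_inner orth_inner_gt0.

Lemma orth_sqr_normE (x : orth) : `|x| ^+ 2 = orth_inner x x.
Proof. exact: sqr_normE. Qed.

HB.instance Definition _ :=
  CompleteNormedModule_isHilbert.Build R orth orth_sqr_normE.

End OrthogonalComplement.

(** * Fixed vectors and the orthogonal decomposition they induce *)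

Section UnitaryRep.
Variables (R : realType) (G : topologicalGroupType) (H : hilbertType R).
Variable pi : unitary_rep G H.
Implicit Types (x y z : H) (S : set G).

Lemma inner_rep g x y : inner (pi g x) (pi g y) = inner x y.
Proof. by have [iso _] := rep_unitary pi g; exact: iso. Qed.

Lemma rdot_rep g x y : rdot (pi g x) (pi g y) = rdot x y.
Proof. by rewrite /rdot inner_rep. Qed.

Lemma sqnrm_rep g x : sqnrm (pi g x) = sqnrm x.
Proof. exact: rdot_rep. Qed.

Lemma nrm_rep g x : nrm (pi g x) = nrm x.
Proof.
by apply/eqP; rewrite -(eqrXn2 (ltn0Sn 1)) ?nrm_ge0 // -!sqnrmE sqnrm_rep.
Qed.

Lemma repK g x : pi g^-1%g (pi g x) = x.
Proof. by rewrite -repM mulVg rep1. Qed.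

Lemma inner_repV g x y : inner (pi g x) y = inner x (pi g^-1%g y).
Proof. by rewrite -(inner_rep g^-1%g) repK. Qed.

Definition fixed S : set H := [set x | forall g, S g -> pi g x = x].

(* The vector of minimal norm in the closed convex hull of the orbit is fixed. *)
Lemma fixed_in_hull S x : S 1%g -> (forall g h, S g -> S h -> S (g * h)%g) ->
  exists2 y, fixed S y &
    forall D, closed_convex D -> (forall g, S g -> D (pi g x)) -> D y.
Proof.
move=> S1 SM.
pose C : set H := [set y | forall D, closed_convex D ->
  (forall g, S g -> D (pi g x)) -> D y].
have Ccc : closed_convex C.
  split=> [y z Cy Cz D Dcc Dx|y Cy D Dcc Dx].
    by apply: Dcc.1; [exact: Cy|exact: Cz].
  by apply: Dcc.2 => e /Cy[z Cz yz]; exists z => //; exact: Cz.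
have C0 : C !=set0 by exists (pi 1%g x) => D _; exact.
have [y Cy ymin] := closed_convex_min Ccc C0.
(* As [pi h] is isometric, [pi h y] is also of least norm; by uniqueness it remains to see that it
   lies in [C]. *)
exists y => // h Sh; apply: (closed_convex_min_unique Ccc Cy _ ymin); last first.
  exact: sqnrm_rep.
(* The preimage of [D] under [pi h] is again closed and convex, and it contains the orbit because
   [S] is stable under products. *)
move=> D [Dmid Dcl] Dx; apply: (Cy [set z | D (pi h z)]); last first.
  by move=> g Sg /=; rewrite -repM; apply/Dx/SM.
split=> [z w /= Dz Dw|z Dz /=].
  by rewrite linearZ linearD; exact: Dmid.
apply: Dcl => e /Dz[w /= Dw zw]; exists (pi h w) => //.
by rewrite -linearB nrm_rep.
Qed.

(** The fixed vector [y] of the orbit hull serves as the projection: for fixed [w], the value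
    [rdot (pi g x) w] is constant on the orbit, hence the same at [y]. Using ['i%C *: w] as well
    gives complex orthogonality. *)
Lemma orthogonal_decomposition S x : S 1%g ->
    (forall g h, S g -> S h -> S (g * h)%g) ->
  exists2 y, fixed S y & orthogonal_pred (fixed S) (x - y).
Proof.
move=> S1 SM; have [y Sy hull] := fixed_in_hull x S1 SM; exists y => //.
have rdot0 w : fixed S w -> rdot (x - y) w = 0.
  move=> Sw; rewrite rdotDl rdotNl (hull _ (closed_convex_hyperplane w (rdot x w))).
    by rewrite subrr.
  by move=> g Sg /=; rewrite -{1}(Sw g Sg) rdot_rep.
apply/asboolP => w Sw; have re0 := rdot0 _ Sw.
have /rdot0 : fixed S ('i%C *: w) by move=> g Sg; rewrite linearZ (Sw g Sg).
rewrite /rdot linearZr_LR /=; move: re0; rewrite /rdot.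
case: (inner _ w) => a b /= ->; rewrite /conjC /=.
by rewrite mul0r sub0r mulN1r opprK => ->.
Qed.

End UnitaryRep.

(** * Restriction along a homomorphism to the complement of a stable set *)

Section Subrepresentation.
Variables (R : realType) (K G : topologicalGroupType) (H : hilbertType R).
Variables (pi : unitary_rep G H) (f : K -> G) (W : set H).
Hypotheses (f1 : f 1%g = 1%g) (fM : forall g h, f (g * h)%g = (f g * f h)%g).
Hypothesis f_continuous : continuous f.
Hypothesis W_stable : forall g w, W w -> W (pi (f g) w).

Lemma orthogonal_rep g x :
  orthogonal_pred W x -> orthogonal_pred W (pi (f g) x).
Proof.
move=> /asboolP ox; apply/asboolP => w Ww.
have fV : ((f g)^-1 = f g^-1)%g by apply: (mulgI (f g)); rewrite mulgV -fM mulgV.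
by rewrite inner_repV fV; apply/ox/W_stable.
Qed.

Definition subrep_fun g (x : orth W) : orth W :=
  Orth (orthogonal_rep g (orth_valP x)).

Lemma subrep_linear g : linear (subrep_fun g).
Proof. by move=> a x y; apply: val_inj; rewrite /= !linearP. Qed.

HB.instance Definition _ g :=
  GRing.isLinear.Build R[i] (orth W) (orth W) _ (subrep_fun g) (subrep_linear g).

Definition subrep_op g : {linear orth W -> orth W} := subrep_fun g.

Lemma subrep1 x : subrep_op 1%g x = x.
Proof. by apply: val_inj; rewrite /= f1 rep1. Qed.

Lemma subrepM g h x : subrep_op (g * h)%g x = subrep_op g (subrep_op h x).
Proof. by apply: val_inj; rewrite /= fM repM. Qed.

Lemma subrep_unitary g : unitary (subrep_op g).
Proof.
split=> [x y|]; first exact: inner_rep.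
by exists (subrep_op g^-1%g) => x; rewrite -subrepM ?mulVg ?mulgV subrep1.
Qed.

Lemma subrep_continuous x : continuous (fun g => subrep_op g x).
Proof.
move=> g; apply/cvgrPdist_lt => e e0.
have /cvgrPdist_lt/(_ e e0) : pi (f h) (val x) @[h --> g] --> pi (f g) (val x).
  apply: (@continuous_comp _ _ _ f (fun h => pi h (val x)) g).
    exact: f_continuous.
  exact: rep_strongly_continuous.
by apply: filterS => h; rewrite orth_normE raddfB.
Qed.

Definition subrep : unitary_rep K (orth W) :=
  UnitaryRep subrep_unitary subrep1 subrepM subrep_continuous.

End Subrepresentation.

(** * Kazhdan sets with a constant independent of the group *)

Section Kazhdan.
Variables (R : realType) (K G : topologicalGroupType) (H : hilbertType R).
Variables (pi : unitary_rep G H) (f : K -> G).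
Hypotheses (f1 : f 1%g = 1%g) (fM : forall g h, f (g * h)%g = (f g * f h)%g).
Hypothesis f_continuous : continuous f.
Hypothesis TK : property_T R K.

Local Notation V := (orthogonal_pred (fixed pi (range f))).

Lemma fixed_range_stable g w :
  fixed pi (range f) w -> fixed pi (range f) (pi (f g) w).
Proof. by move=> Ww; rewrite Ww //; exists g. Qed.

(** An invariant unit vector of the complement of [fixed pi (range f)] would be orthogonal to
    itself. So property (T) rules out almost invariant vectors there, which yields [Q] and [e]. *)
Lemma kazhdan_pair : exists (Q : set K) (e : R), [/\ compact Q, Q 1%g, 0 < e <= 1 &
  forall z, V z -> exists2 g, Q g & e * sqnrm z <= sqnrm (pi (f g) z - z)].
Proof.
pose rho := subrep f1 fM f_continuous fixed_range_stable.
have noinv : ~ has_invariant_unit_vector rho.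
  move=> [xi [xi1 inv]].
  have Wxi : fixed pi (range f) (val xi).
    by move=> _ [g _ <-]; have /(congr1 val) := inv g.
  have := sqr_normE (val xi); move/asboolP: (orth_valP xi) => -> //.
  by rewrite -orth_normE xi1 expr1n => /eqP; rewrite oner_eq0.
have noalm : ~ has_almost_invariant_vectors rho by move=> /TK.
have [e [Q [e0 cQ hQ]]] : exists (e : R) (Q : set K), [/\ 0 < e, compact Q &
    forall xi : orth (fixed pi (range f)), `|xi| = 1 ->
      exists2 g, Q g & ~ (`|xi - rho g xi| < e%:C)].
  apply: contrapT => nex; apply: noalm => e Q e0 cQ.
  apply: contrapT => nxi; apply: nex; exists e, Q; split=> // xi xi1.
  apply: contrapT => ng; apply: nxi; exists xi; split=> // g Qg.
  by apply: contrapT => nlt; apply: ng; exists g.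
(* The bound is on squared norms, hence [e ^+ 2]; the cap at 1 keeps the later contraction factor
   [1 - e / 4] nonnegative. The identity covers [z = 0] here and makes the powers of the set
   increasing. *)
exists (Q `|` [set 1%g]), (Num.min (e ^+ 2) 1); split.
- by apply: compactU => //; exact: compact_set1.
- by right.
- by rewrite lt_min ltr01 exprn_gt0 //= ge_min lexx orbT.
move=> z Vz; have [z0|z0] := eqVneq z 0.
  by exists 1%g; [right|rewrite z0 sqnrm0 mulr0 sqnrm_ge0].
have nz : 0 < nrm z by rewrite -ltcR -normE normr_gt0.
have [|g Qg] := hQ ((nrm z)^-1%:C *: Orth Vz).
  rewrite normrZ orth_normE /= normE ger0_norm ?ler0c ?invr_ge0 ?ltW //.
  by rewrite -rmorphM mulVf ?gt_eqF.
rewrite orth_normE => /negP; rewrite normE ltcR -leNgt => h.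
exists g; first by left.
have {h} : e ^+ 2 <= sqnrm (val ((nrm z)^-1%:C *: Orth Vz
    - rho g ((nrm z)^-1%:C *: Orth Vz))).
  by rewrite sqnrmE ler_pXn2r ?nnegrE ?nrm_ge0 // ltW.
rewrite linearZ -scalerBr linearZ sqnrmZ raddfB /= -sqnrmN opprB.
rewrite exprVn -sqnrmE -ler_pdivrMl ?invr_gt0 ?sqnrmE ?exprn_gt0 // invrK -sqnrmE.
apply: le_trans; rewrite mulrC ler_wpM2l ?sqnrm_ge0 //.
by rewrite ge_min lexx.
Qed.

Fixpoint set_power (Q : set K) n : set K :=
  if n is m.+1 then (fun x : K * K => x.1 * x.2)%g @` (set_power Q m `*` Q)
  else [set 1%g].

Lemma set_power_compact Q n : compact Q -> compact (set_power Q n).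
Proof.
move=> cQ; elim: n => [|n IH] /=; first exact: compact_set1.
apply: continuous_compact; last exact: compact_setX.
by apply: continuous_subspaceT; exact: mulg_continuous.
Qed.

Lemma set_power1 (Q : set K) n : Q 1%g -> set_power Q n 1%g.
Proof. by move=> Q1; elim: n => [|n IH] //=; exists (1%g, 1%g); rewrite ?mulg1. Qed.

(* Each step replaces z by the midpoint of z and a translate pi (f h) z, whose
   orbit under [set_power Q n] has its convex hull in that of the orbit of z
   under [set_power Q n.+1]. *)
Lemma midpoint_contraction (Q : set K) e : Q 1%g -> 0 < e <= 1 ->
    (forall z, V z -> exists2 g, Q g & e * sqnrm z <= sqnrm (pi (f g) z - z)) ->
  forall n u (t : R) z, V z ->
    (forall g, set_power Q n g -> t <= rdot (pi (f g) z) u) ->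
  exists2 v, t <= rdot v u & sqnrm v <= (1 - e / 4) ^+ n * sqnrm z.
Proof.
move=> Q1 /andP[e0 e1] hQ n u t; elim: n => [|n IH] z Vz ht.
  exists z; last by rewrite expr0 mul1r.
  by have := ht 1%g erefl; rewrite f1 rep1.
have [h Qh hz] := hQ z Vz.
pose z' := 2^-1%:C *: (pi (f h) z + z).
have Vh : V (pi (f h) z).
  exact: (orthogonal_rep (pi := pi) f1 fM fixed_range_stable).
have Vz' : V z'.
  have [_ V_lin] := GRing.subsemimod_closed_submod (orthogonal_closed (fixed pi (range f))).
  have V0 : V 0 by apply/asboolP => w _; rewrite linear0l.
  have Vs : V (1 *: pi (f h) z + z) by exact: V_lin.
  by have := V_lin 2^-1%:C _ _ Vs V0; rewrite scale1r addr0.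
have [|v tv vz'] := IH z' Vz'.
  move=> g Qg; rewrite linearZ linearD /= rdotZl rdotDl -repM -fM.
  have h1 : t <= rdot (pi (f (g * h)%g) z) u by apply: ht; exists (g, h).
  have h2 : t <= rdot (pi (f g) z) u by rewrite -(mulg1 g); apply: ht; exists (g, 1%g).
  lra.
exists v => //; apply: le_trans vz' _.
rewrite exprSr -mulrA ler_wpM2l ?exprn_ge0 //; first by lra.
(* By the parallelogram identity [sqnrm z'] is [sqnrm z] minus a quarter of the squared
   displacement, hence the factor [1 - e / 4]. *)
move: hz; rewrite (parallelogram (pi (f h) z) z) -/z' sqnrm_rep; lra.
Qed.

(** If a large power of [Q] moved [z] too little, the contraction would give a vector of small norm
    whose inner product with [z] is still large. *)
Lemma uniform_kazhdan_set : exists Q : set K, compact Q /\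
  forall z, V z -> exists2 g, Q g & 2^-1 * sqnrm z <= sqnrm (pi (f g) z - z).
Proof.
have [Q [e [cQ Q1 /andP[e0 e1] hQ]]] := kazhdan_pair.
have [n hn] : exists n, (1 - e / 4) ^+ n < 2^-1.
  have : (fun n => (1 - e / 4) ^+ n) @ \oo --> (0 : R).
    by apply: cvg_expr; rewrite ger0_norm; lra.
  move=> /cvgrPdist_lt /(_ 2^-1) []; first by rewrite invr_gt0.
  move=> n _ hn; exists n; have := hn n (leqnn n).
  by rewrite /= sub0r normrN; apply: le_lt_trans; exact: ler_norm.
exists (set_power Q n); split=> [|z Vz]; first exact: set_power_compact.
apply: contrapT => nex.
have far g : set_power Q n g -> sqnrm (pi (f g) z - z) < 2^-1 * sqnrm z.
  by move=> Qg; rewrite ltNge; apply/negP => h; apply: nex; exists g.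
have z0 : 0 < sqnrm z.
  by have := far _ (set_power1 n Q1); rewrite f1 rep1 subrr sqnrm0; lra.
(* A squared displacement below half of [sqnrm z] means [rdot (pi (f g) z) z] exceeds 3/4 of
   [sqnrm z]. With [sqnrm v] below half of [sqnrm z], the square norm of [v - z] would be less than
   (1/2 - 3/2 + 1) [sqnrm z], that is, negative. *)
have [|||v vz vn] := @midpoint_contraction Q e Q1 _ _ n z (3 / 4 * sqnrm z) z Vz.
- by rewrite e0.
- exact: hQ.
- by move=> g /far; rewrite sqnrmB sqnrm_rep; lra.
have := sqnrm_ge0 (v - z); rewrite sqnrmB.
have : (1 - e / 4) ^+ n * sqnrm z < 2^-1 * sqnrm z by rewrite ltr_pM2r.
lra.
Qed.

End Kazhdan.

(** * Coordinate subgroups of the product *)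

Section Products.
Variables (I : Type) (Gamma : I -> topologicalGroupType).
Local Notation G := (prod_topology Gamma).
Local Notation J := {classic I}.
Implicit Types (g h : G) (i j : J) (s : seq J).

(** Changing one coordinate needs decidable equality of indices, which [{classic I}] supplies for an
    arbitrary [I]. *)
Definition update g i (x : Gamma i) : G := @dfwith J Gamma g i x.
Definition embed i (x : Gamma i) : G := update 1%g x.
Definition trivial_on s : set G := [set g | forall i, i \in s -> g i = 1%g].

Lemma update_in g i (x : Gamma i) : update g x i = x.
Proof. exact: dfwithin. Qed.

Lemma update_out g i (x : Gamma i) j : i != j -> update g x j = g j.
Proof. exact: dfwithout. Qed.

Lemma embed_in i (x : Gamma i) : embed x i = x.
Proof. exact: update_in. Qed.

Lemma embed_out i (x : Gamma i) j : i != j -> embed x j = 1%g.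
Proof. exact: update_out. Qed.

Lemma prod_ext g h : (forall i, g i = h i) -> g = h.
Proof. exact: functional_extensionality_dep. Qed.

Lemma embed_update g i (x y : Gamma i) :
  (embed x * update g y)%g = update g (x * y)%g.
Proof.
apply: prod_ext => j; have [<-|ij] := eqVneq i j.
  by rewrite -[LHS]/(embed x i * update g y i)%g embed_in !update_in.
by rewrite -[LHS]/(embed x j * update g y j)%g embed_out // !update_out // mul1g.
Qed.

Lemma embed1 i : @embed i 1%g = 1%g.
Proof.
by apply: prod_ext => j; have [<-|ij] := eqVneq i j;
  rewrite ?embed_in ?embed_out.
Qed.

Lemma embedM i (x y : Gamma i) : embed (x * y)%g = (embed x * embed y)%g.
Proof. by rewrite embed_update. Qed.

Lemma embed_coord g i : (embed (g i) * @update g i 1)%g = g.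
Proof.
rewrite embed_update mulg1; apply: prod_ext => j.
by have [<-|ij] := eqVneq i j; rewrite ?update_in ?update_out.
Qed.

(** Each factor is normal in the product, so its fixed vectors are stable under the whole group. *)
Lemma embed_conj g i (x : Gamma i) :
  (embed x * g = g * embed ((g i)^-1 * x * g i))%g.
Proof.
apply: prod_ext => j; have [<-|ij] := eqVneq i j.
  rewrite -[LHS]/(embed x i * g i)%g -[RHS]/(g i * embed _ i)%g !embed_in.
  by rewrite !mulgA mulgV mul1g.
rewrite -[LHS]/(embed x j * g j)%g -[RHS]/(g j * embed _ j)%g.
by rewrite !embed_out // mul1g mulg1.
Qed.

Lemma embed_continuous i : continuous (@embed i).
Proof. exact: (@dfwith_continuous J Gamma). Qed.

(* The subgroups [trivial_on s] form a filter base converging to the identity. *)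
Lemma nbhs1_trivial_on (A : set G) :
  nbhs (1%g : G) A -> exists s, trivial_on s `<=` A.
Proof.
pose F : set_system G := filter_from [set: seq J] trivial_on.
have FF : Filter F.
  apply: filter_from_filter; first by exists [::].
  move=> s t _ _; exists (s ++ t) => // g gst.
  by split=> i hi; apply: gst; rewrite mem_cat hi ?orbT.
have F1 : F --> (1%g : G).
  apply: prod_cvg => i B /nbhs_singleton B1.
  exists [:: (i : J)] => // g /(_ (i : J)); rewrite mem_seq1 eqxx => /(_ isT) gi.
  by rewrite /preimage /= gi.
by move=> /F1[s _ sA]; exists s.
Qed.

End Products.

(** * Displacement of vectors fixed by almost all factors *)

Section ProductRep.
Variables (R : realType) (I : Type) (Gamma : I -> topologicalGroupType).
Variables (H : hilbertType R) (pi : unitary_rep (prod_topology Gamma) H).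
Local Notation G := (prod_topology Gamma).
Local Notation J := {classic I}.
Local Notation W i := (fixed pi (range (@embed I Gamma i))).
Local Notation V i := (orthogonal_pred (W i)).

Lemma fixed_factor_stable (i : J) g w : W i w -> W i (pi g w).
Proof.
by move=> Ww _ [x _ <-]; rewrite -repM embed_conj repM Ww //; eexists.
Qed.

Lemma orthogonal_factor_stable (i : J) g z : V i z -> V i (pi g z).
Proof.
exact: (orthogonal_rep (f := id) erefl (fun _ _ => erefl) (@fixed_factor_stable i)).
Qed.

Lemma rdot_fixed_orthogonal (i : J) y z : W i y -> V i z -> rdot y z = 0.
Proof. by move=> Wy /asboolP zy; rewrite rdotC /rdot zy. Qed.

Lemma fixedB (S : set G) x y : fixed pi S x -> fixed pi S y -> fixed pi S (x - y).
Proof. by move=> Sx Sy g Sg; rewrite linearB /= Sx ?Sy. Qed.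

(** Lets the i-th coordinate be chosen freely without changing the action on [W i]: it splits off as
    an element of the factor, which fixes every translate of [y]. *)
Lemma fixed_update (i : J) g (a b : Gamma i) y :
  W i y -> pi (update g a) y = pi (update g b) y.
Proof.
move=> Wy; rewrite -(mulg1 a) -(mulg1 b) -!embed_update !repM.
by rewrite !(fixed_factor_stable _ Wy) //; eexists.
Qed.

Variable Q : forall i : J, set (Gamma i).
Hypothesis hQ : forall (i : J) z, V i z -> exists2 x, @Q i x &
  2^-1 * sqnrm z <= sqnrm (pi (embed x) z - z).
Hypothesis no_invariant : forall x : H, (forall g, pi g x = x) -> x = 0.

(** Induction on [s], splitting [x = y + z] along [W i] and [V i]. Both parts are stable under the
    group, so their displacements are orthogonal and the squares add; hence the constant does not
    degrade with the length of [s]. *)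
Lemma displacement (s : seq J) x : fixed pi (trivial_on s) x ->
  exists2 k : G, (forall i : J, (@Q i `|` [set 1%g]) (k i)) &
    8^-1 * sqnrm x <= sqnrm (pi k x - x).
Proof.
elim: s x => [|i s IH] x Sx.
  (* For the empty list [trivial_on] is the whole group, so [x] is invariant and vanishes. *)
  exists 1%g => [i|]; first by right.
  by rewrite [x]no_invariant ?sqnrm0 ?mulr0 ?sqnrm_ge0 // => g; exact: Sx.
have [|g h [a _ <-] [b _ <-]|y Wy Vz] :=
    orthogonal_decomposition pi (S := range (@embed I Gamma i)) x.
- by exists 1%g => //; exact: embed1.
- by exists (a * b)%g => //; exact: embedM.
move: (x - y) (subrKC y x) Vz => z ez Vz.
(* The i-th coordinate of [g] may be dropped, and the resulting [g'] fixes [x]. Then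
   [pi g' y - y = z - pi g' z] lies in both [W i] and [V i], so it is zero. *)
have Sy : fixed pi (trivial_on s) y.
  move=> g gs; rewrite -(embed_coord g i) repM (fixed_factor_stable _ Wy) ; last by eexists.
  pose g' := @update I Gamma g i 1%g.
  have g'x : pi g' x = x.
    apply: Sx => j; rewrite inE; have [-> _|ji /= js] := eqVneq j i.
      exact: update_in.
    by rewrite /g' update_out 1?eq_sym // gs.
  apply/eqP; rewrite -subr_eq0 -/g'; apply/eqP/sqnrm_eq0.
  have e : pi g' y - y = z - pi g' z.
    apply/eqP; rewrite subr_eq addrAC eq_sym subr_eq.
    by rewrite -linearD ez g'x addrC ez.
  rewrite {1}/sqnrm {2}e rdotDr rdotNr.
  have Wd : W i (pi g' y - y) by apply: fixedB => //; exact: fixed_factor_stable.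
  by rewrite !(rdot_fixed_orthogonal Wd) ?subr0 //; exact: orthogonal_factor_stable.
have [k Qk ky] := IH y Sy.
pose k1 := @update I Gamma k i 1%g.
have [h Qh hz] := hQ (orthogonal_factor_stable k1 Vz).
pose k2 := update k h.
have k2E : k2 = (embed h * k1)%g by rewrite embed_update mulg1.
have yk a : pi (@update I Gamma k i a) y = pi k y.
  rewrite -[in RHS](embed_coord k i) embed_update; exact: fixed_update.
(* The vectors [pi k1 z] and [pi k2 z] are at squared distance at least half of [sqnrm z]. If both
   were within squared distance 1/8 of [z], relative to [sqnrm z], theirs would be below 2 (1/8 +
   1/8) = 1/2. *)
have [a Qa za] : exists2 a, (@Q i `|` [set 1%g]) a &
    8^-1 * sqnrm z <= sqnrm (pi (update k a) z - z).
  have [h1|h1] := leP (8^-1 * sqnrm z) (sqnrm (pi k1 z - z)).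
    by exists 1%g; [right|].
  exists h; first by left.
  have := sqnrm_ge0 ((pi k2 z - z) + (pi k1 z - z)); rewrite sqnrmD.
  move: hz; rewrite -repM -k2E.
  have -> : pi k2 z - pi k1 z = (pi k2 z - z) - (pi k1 z - z).
    by rewrite opprB addrA subrK.
  by rewrite [in X in X -> _]sqnrm_rep sqnrmB -/k2; lra.
exists (update k a).
  move=> j; have [<-|ij] := eqVneq i j; first by rewrite update_in.
  by rewrite update_out.
have -> : pi (update k a) x - x = (pi (update k a) y - y) + (pi (update k a) z - z).
  by rewrite -ez linearD opprD addrACA.
have Wd : W i (pi (update k a) y - y).
  by apply: fixedB => //; exact: fixed_factor_stable.
have dz : rdot (pi (update k a) y - y) (pi (update k a) z - z) = 0.
  rewrite rdotDr rdotNr !(rdot_fixed_orthogonal Wd) ?subr0 //.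
  exact: orthogonal_factor_stable.
rewrite sqnrmD dz -ez sqnrmD (rdot_fixed_orthogonal Wy Vz) yk; lra.
Qed.

End ProductRep.

(** * Property (T) for the product *)

Theorem theorem8p9 (R : realType) (I : Type)
    (Gamma : I -> topologicalGroupType) :
  (forall i : I, property_T R (Gamma i)) ->
  property_T R (prod_topology Gamma).
Proof.
move=> TGamma H pi almost_inv; apply: contrapT => noinv.
have no_invariant (x : H) : (forall g, pi g x = x) -> x = 0.
  move=> xinv; apply: contrapT => /eqP x0; apply: noinv.
  have nx : 0 < nrm x by rewrite -ltcR -normE normr_gt0.
  exists ((nrm x)^-1%:C *: x); split=> [|g]; last by rewrite linearZ xinv.
  rewrite normrZ [`|x|]normE ger0_norm ?ler0c ?invr_ge0 ?ltW //.
  by rewrite -rmorphM mulVf ?gt_eqF.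
have Qex (i : {classic I}) := uniform_kazhdan_set pi (@embed1 I Gamma i)
  (@embedM I Gamma i) (@embed_continuous I Gamma i) (TGamma i).
pose Q i := sval (cid (Qex i)).
have Qc i : compact (Q i) by exact: (svalP (cid (Qex i))).1.
have hQ i := (svalP (cid (Qex i))).2.
have Kc : compact [set k : prod_topology Gamma |
    forall i : {classic I}, (Q i `|` [set 1%g]) (k i)].
  apply: (@tychonoff {classic I} Gamma (fun i => Q i `|` [set 1%g])) => i.
  by apply: compactU => //; exact: compact_set1.
(* With 1/16, the fixed vector [c] has norm at least 15/16 and is moved by at most 3/16 on the
   compact set, while [displacement] would force the square of 3/16 to be at least 1/8 of the square
   of 15/16. *)
have e0 : 0 < 16^-1 :> R by rewrite invr_gt0.
have [xi [xi1 xiK]] := almost_inv _ _ e0 Kc.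
have nxi : nrm xi = 1 by rewrite /nrm xi1.
have [s hs] : exists s, trivial_on s `<=`
    [set g : prod_topology Gamma | nrm (pi g xi - xi) <= 16^-1].
  apply: (@nbhs1_trivial_on I Gamma).
  have e0' : 0 < (16^-1 : R)%:C by rewrite ltcR.
  have /cvgrPdist_lt/(_ _ e0') :
      pi g xi @[g --> (1%g : prod_topology Gamma)] --> pi 1%g xi.
    exact: rep_strongly_continuous.
  by apply: filterS => g /=; rewrite rep1 normE ltcR nrmBC => /ltW.
have [|g h gs hs' i si|c cfix chull] := fixed_in_hull pi (S := trivial_on s) xi.
- by [].
- by rewrite -[LHS]/(g i * h i)%g gs // hs' // mulg1.
(* The closed ball around [xi] is convex and contains the orbit, hence also the hull vector [c]. *)
have cxi : nrm (c - xi) <= 16^-1 by apply: chull (closed_convex_ball _ _) _.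
have [k Kk ck] := displacement hQ no_invariant cfix.
have kxi : nrm (xi - pi k xi) < 16^-1 by rewrite -ltcR -normE; exact: xiK.
have kc : nrm (pi k c - c) <= 3 / 16.
  have -> : pi k c - c = pi k (c - xi) + ((pi k xi - xi) + (xi - c)).
    by rewrite linearB !addrA !subrK.
  have := nrmD (pi k (c - xi)) ((pi k xi - xi) + (xi - c)).
  have := nrmD (pi k xi - xi) (xi - c).
  by rewrite nrm_rep (nrmBC (pi k xi)) (nrmBC xi c); lra.
have nc : 15 / 16 <= nrm c.
  by have := nrmD (xi - c) c; rewrite subrK nxi (nrmBC xi); lra.
move: ck; rewrite !sqnrmE; have := nrm_ge0 (pi k c - c).
move: (nrm _) (nrm c) kc nc => a b; nra.
Qed.
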